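(* Let $D=(V,A)$ be a digraph, $w\in\mathbb{R}_{\ge0}^A$, and $b\in\mathbb{Z}_{>0}^V$. Define $g:\mathbb{Z}^V\to\mathbb{R}\cup\{+\infty\}$ by $$g(x)=\min\{w(B): B \text{ is a } b\text{-branching in } D,\ d^-_B+x\ge b\}$$ if $x\in\mathbb{Z}_{\ge0}^V$ and $D$ has a $b$-branching $B$ with $d^-_B+x\ge b$, and $g(x)=+\infty$ otherwise. Then $g$ is $\mathrm{M}^\natural$-convex.
   Context: Digraphs are loopless. $d^-_B\in\mathbb{Z}^V$ is the vector of indegrees in $(V,B)$; $w(B)=\sum_{a\in B}w(a)$; $B[X]$ is the set of arcs of $B$ with both ends in $X$, $b(X)=\sum_{v\in X}b(v)$. An arc set $B\subseteq A$ is a $b$-branching if $d^-_B(v)\le b(v)$ for all $v\in V$ and $|B[X]|\le b(X)-1$ for every nonempty $X\subseteq V$. For $x\in\mathbb{Z}^V$, $\mathrm{supp}^+(x)=\{v:x(v)>0\}$, $\mathrm{supp}^-(x)=\{v:x(v)<0\}$, and $\chi_v$ is the unit vector of $v$. A function $f:\mathbb{Z}^V\to\mathbb{R}\cup\{+\infty\}$ is $\mathrm{M}^\natural$-convex if for all $x,y\in\mathbb{Z}^V$ and $u\in\mathrm{supp}^+(x-y)$, either $f(x)+f(y)\ge f(x-\chi_u)+f(y+\chi_u)$, or there is $v\in\mathrm{supp}^-(x-y)$ with $f(x)+f(y)\ge f(x-\chi_u+\chi_v)+f(y+\chi_u-\chi_v)$. *)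

(* Defs.v *)
From HB Require Import structures.
From mathcomp Require Import all_boot all_order all_algebra.
Set Implicit Arguments. Unset Strict Implicit. Unset Printing Implicit Defensive.
Import Order.TTheory GRing.Theory Num.Theory.
Local Open Scope ring_scope.

Section Defs.
Variables (V A : finType) (tail head : A -> V).

Definition indeg (B : {set A}) (v : V) : int := #|[set a in B | head a == v]|%:Z.

Definition induced (B : {set A}) (X : {set V}) : {set A} :=
  [set a in B | (tail a \in X) && (head a \in X)].

Definition bsum (b : V -> int) (X : {set V}) : int := \sum_(v in X) b v.

Definition is_b_branching (b : V -> int) (B : {set A}) : bool :=
  [forall v, indeg B v <= b v] &&
  [forall X : {set V}, (X != set0) ==> (#|induced B X|%:Z <= bsum b X - 1)].

Variable R : realFieldType.

Definition wsum (w : A -> R) (B : {set A}) : R := \sum_(a in B) w a.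

(* R ∪ {+oo}: None stands for +oo *)
Definition emin (p q : option R) : option R :=
  match p, q with
  | None, _ => q
  | _, None => p
  | Some x, Some y => Some (Num.min x y)
  end.

Definition eadd (p q : option R) : option R :=
  match p, q with
  | Some x, Some y => Some (x + y)
  | _, _ => None
  end.

Definition ege (p q : option R) : Prop :=
  match p, q with
  | None, _ => True
  | Some _, None => False
  | Some x, Some y => y <= x
  end.

Definition feasible (b : V -> int) (x : V -> int) (B : {set A}) : bool :=
  is_b_branching b B && [forall v, b v <= indeg B v + x v].

Definition gfun (b : V -> int) (w : A -> R) (x : V -> int) : option R :=
  if [forall v, 0 <= x v] then
    \big[emin/None]_(B : {set A} | feasible b x B) Some (wsum w B)
  else None.
End Defs.

Definition unitv (V : finType) (v : V) : V -> int := fun t => (t == v)%:Z.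

Definition Mnat_convex (V : finType) (R : realFieldType) (f : (V -> int) -> option R) : Prop :=
  forall (x y : V -> int) (u : V), y u < x u ->
    ege (eadd (f x) (f y))
        (eadd (f (fun t => x t - unitv u t)) (f (fun t => y t + unitv u t)))
    \/ exists v : V, x v < y v /\
       ege (eadd (f x) (f y))
           (eadd (f (fun t => x t - unitv u t + unitv v t))
                 (f (fun t => y t + unitv u t - unitv v t))).

(* Main.v *)
Require Import Defs.
From HB Require Import structures.
From mathcomp Require Import all_boot all_order all_algebra zify.
Set Implicit Arguments.
Unset Strict Implicit.
Unset Printing Implicit Defensive.
Import Order.TTheory GRing.Theory Num.Theory.
Local Open Scope ring_scope.

(** Counting arcs by head, [B] is a [b]-branching iff [indeg B <= b] and every
    nonempty [X] avoiding the roots [{v | indeg B v < b v}] is entered by an arc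
    of [B].  Hence, by Edmonds' disjoint branchings theorem for two branchings,
    the multiset union of two [b]-branchings can be split again with prescribed
    indegrees below [b] as soon as every nonempty [X] is entered by at least as
    many arcs as there are prescribed root sets missing [X].

    Let [indeg B1 u < indeg B2 u].  If moving one unit of indegree at [u] from
    [B2] to [B1] violates this cut condition, then some [X] containing [u] is
    entered by no arc of [B1] or [B2] and has no root of the new first part.
    Take [X] minimal and a root [v] of [B2] in [X]; all of [X] except [u] is
    saturated by [B1], so [indeg B2 v < b v <= indeg B1 v], and moving one unit
    at [v] the other way restores the cut condition. *)

(** * Cut conditions and packing of two arc sets *)

Section Cuts.
Local Open Scope nat_scope.
Variables (V E : finType) (tail head : E -> V).
Implicit Types (S F : {set E}) (R U X Y : {set V}).

Definition entering S X := [set e in S | (tail e \notin X) && (head e \in X)].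

(** Cut form of reachability: every vertex can be reached from [R] along arcs of [S]. *)
Definition covers S R :=
  forall X, X != set0 -> [disjoint X & R] -> entering S X != set0.

Lemma enteringP S X e :
  reflect [/\ e \in S, tail e \notin X & head e \in X] (e \in entering S X).
Proof. by rewrite inE; apply: and3P. Qed.

(** An arc entering [X :&: Y] or [X :|: Y] enters [X] or [Y], and an arc entering both of the former
    enters both of the latter. *)
Lemma entering_submod S X Y :
  #|entering S (X :&: Y)| + #|entering S (X :|: Y)|
    <= #|entering S X| + #|entering S Y|.
Proof.
rewrite -cardsUI -(cardsUI (entering S X)).
apply: leq_add; apply: subset_leq_card; apply/subsetP => e; rewrite !inE;
  by case: (e \in S); case: (tail e \in X); case: (tail e \in Y);
     case: (head e \in X); case: (head e \in Y).
Qed.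

(* Lovász's step: an arc leaving [U] can be removed from [S :\: F] without
   destroying the cut condition towards [R2].  It is chosen with tail in a
   minimal tight set, if there is any. *)
Lemma packing_step S F R1 R2 U :
    covers S R1 ->
    (forall X, X != set0 -> [disjoint X & R1] -> [disjoint X & R2] ->
       1 < #|entering S X|) ->
    R1 \subset U -> U != setT -> (forall e, e \in F -> head e \in U) ->
    covers (S :\: F) R2 ->
  exists e, [/\ e \in S, tail e \in U, head e \notin U
              & covers (S :\: (e |: F)) R2].
Proof.
move=> covS1 covS12 sR1U UnT headF covSF.
have enterF X : [disjoint X & U] -> entering (S :\: F) X = entering S X.
  move=> dXU; apply/setP => e; rewrite !inE.
  case: (boolP (e \in F)) => //= eF.
  by rewrite (disjointFl dXU (headF _ eF)) !andbF.
have gt1 X : X != set0 -> [disjoint X & U] -> [disjoint X & R2] ->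
    1 < #|entering (S :\: F) X|.
  move=> X0 dXU dXR2; rewrite enterF //; apply: covS12 => //.
  by rewrite disjoint_sym; apply: disjointWl sR1U _; rewrite disjoint_sym.
(* Only a tight set can lose its last entering arc by the removal of an arc with head outside [U],
   so an arc leaving [U] and entering no tight set will do. *)
pose tight X := [&& [disjoint X & R2], #|entering (S :\: F) X| <= 1
                  & X :\: U != set0].
suff [e [eS teU heU ntight]] : exists e, [/\ e \in S, tail e \in U, head e \notin U
    & forall Y, tight Y -> ~ (tail e \notin Y /\ head e \in Y)].
  exists e; split=> // Y Y0 dYR2; apply/negP => /eqP Ye0.
  have sub1 : entering (S :\: F) Y \subset [set e].
    apply/subsetP => e' /enteringP [e'SF te' he']; rewrite inE.
    apply: contraT => ne; have : e' \in entering (S :\: (e |: F)) Y.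
      apply/enteringP; split=> //; move: e'SF; rewrite !inE negb_or ne.
      by case/andP => -> ->.
    by rewrite Ye0 inE.
  have /set0Pn [e1 e1Y] := covSF Y Y0 dYR2.
  have /set1P e1e := subsetP sub1 _ e1Y; subst e1.
  case/enteringP: e1Y => _ teY heY.
  apply: (ntight Y); last by split.
  apply/and3P; split=> //; first by rewrite (leq_trans (subset_leq_card sub1)) ?cards1.
  by apply/set0Pn; exists (head e); rewrite inE heU.
case: (boolP [exists X, tight X]) => [/existsP exX | /existsPn noX]; last first.
  have CU0 : ~: U != set0.
    by apply: contraNneq UnT => CU; rewrite -(setCK U) CU setC0.
  have dCU : [disjoint ~: U & R1] by rewrite disjoint_sym disjoints_subset setCK.
  have /set0Pn [e /enteringP [eS]] := covS1 _ CU0 dCU.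
  rewrite !inE negbK => teU heU; exists e; split=> // Y tY.
  by rewrite (negPf (noX Y)) in tY.
have [X /minsetP [/and3P [dXR2 leX XU0] minX]] := ex_minset exX.
(* [X :\: U] is entered by two arcs and the tight [X] by at most one, so some arc runs from
   [X :&: U] to [X :\: U]. *)
have : 1 < #|entering (S :\: F) (X :\: U)|.
  apply: gt1 => //; last by apply: disjointWl dXR2; apply: subsetDl.
  by rewrite disjoint_sym disjoints_subset setCD subsetUr.
move=> lt1; have [e eXU neX] : exists2 e, e \in entering (S :\: F) (X :\: U)
    & e \notin entering (S :\: F) X.
  apply/subsetPn; apply: contraL lt1 => /subset_leq_card le.
  by rewrite -leqNgt (leq_trans le).
case/enteringP: eXU => eSF; rewrite !inE negb_and negbK.
move=> teXU /andP [heU heX].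
have teX : tail e \in X.
  by apply: contraR neX => teX; apply/enteringP.
have teU : tail e \in U by rewrite teX orbF in teXU.
exists e; split=> //; first by case/setDP: eSF.
move=> Y /and3P [dYR2 leY _] [teY heY].
have hXY : head e \in X :&: Y by rewrite inE heX.
have XY0 : X :&: Y != set0 by apply/set0Pn; exists (head e).
have XuY0 : X :|: Y != set0 by apply/set0Pn; exists (head e); rewrite inE heX.
have dXY : [disjoint X :&: Y & R2] by apply: disjointWl dXR2; apply: subsetIl.
have dXuY : [disjoint X :|: Y & R2].
  by rewrite disjoints_subset subUset -!disjoints_subset dXR2.
have := covSF _ XuY0 dXuY; rewrite -card_gt0.
have := entering_submod (S :\: F) X Y => sub gt0.
(* If the arc entered a tight [Y], then [X :&: Y] would be tight too, by submodularity and because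
   [X :|: Y] is still entered. Minimality gives [X :&: Y = X], which puts the tail in [Y]. *)
have XYX : X :&: Y = X.
  apply: minX; last exact: subsetIl.
  apply/and3P; split=> //.
    rewrite -(leq_add2r 1); apply: leq_trans (leq_trans sub (leq_add leX leY)).
    exact: leq_add.
  by apply/set0Pn; exists (head e); rewrite inE heU.
by move: teY; rewrite -XYX inE in teX; case/andP: teX => _ ->.
Qed.

(** Edmonds' theorem for two root sets: [F] grows from [R1] arc by arc, and [packing_step] keeps the
    remainder covering towards [R2]. *)
Theorem packing2 S R1 R2 :
    covers S R1 -> covers S R2 ->
    (forall X, X != set0 -> [disjoint X & R1] -> [disjoint X & R2] ->
       1 < #|entering S X|) ->
  exists F, [/\ F \subset S, {in F &, injective head},
    forall e, e \in F -> head e \notin R1, covers F R1 & covers (S :\: F) R2].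
Proof.
move=> covS1 covS2 covS12.
(* [U] is the vertex set reached so far. The covering invariant concerns only sets meeting [U] and
   becomes [covers F R1] once [U] is everything. *)
suff grow n F U : #|~: U| = n -> R1 \subset U -> F \subset S ->
    {in F &, injective head} -> (forall e, e \in F -> head e \in U :\: R1) ->
    (forall X, [disjoint X & R1] -> ~~ [disjoint X & U] -> entering F X != set0) ->
    covers (S :\: F) R2 ->
  exists F, [/\ F \subset S, {in F &, injective head},
    forall e, e \in F -> head e \notin R1, covers F R1 & covers (S :\: F) R2].
  apply: (grow _ set0 R1) => //; first exact: sub0set.
  - by move=> e; rewrite inE.
  - by move=> e; rewrite inE.
  - by move=> X ->.
  - by rewrite setD0.
elim: n F U => [|n IHn] F U cardU sR1U FS injF headF covF covSF.
  exists F; split=> //; first by move=> e /headF; case/setDP.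
  move=> X X0 dX; apply: covF => //.
  have -> : U = setT by rewrite -(setCK U) (cards0_eq cardU) setC0.
  by rewrite disjoints_subset setCT subset0.
have UnT : U != setT by apply/eqP => UT; rewrite UT setCT cards0 in cardU.
have headU e : e \in F -> head e \in U by move/headF; case/setDP.
have [e [eS teU heU covSe]] := packing_step covS1 covS12 sR1U UnT headU covSF.
apply: (IHn (e |: F) (head e |: U)) => //.
- by apply: eq_add_S; rewrite -cardU setCU setIC -setDE (cardsD1 (head e) (~: U)) inE heU.
- by apply: subset_trans sR1U _; apply: subsetUr.
- by rewrite subUset sub1set eS.
- move=> x y /setU1P [-> | xF] /setU1P [-> | yF] //.
  + by move=> hxy; rewrite hxy headU in heU.
  + by move=> hxy; rewrite -hxy headU in heU.
  + exact: injF.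
- move=> x /setU1P [-> | /headF]; last first.
    by case/setDP => xU xR; rewrite !inE xR xU orbT.
  rewrite !inE eqxx andbT; apply: contra heU; exact: (subsetP sR1U).
- move=> X dX dXU; case: (boolP [disjoint X & U]) => dXU'; last first.
    have /set0Pn [x /enteringP [xF tx hx]] := covF X dX dXU'.
    by apply/set0Pn; exists x; apply/enteringP; rewrite !inE xF orbT.
  apply/set0Pn; exists e; apply/enteringP; split.
  + by rewrite !inE eqxx.
  + by rewrite (disjointFl dXU' teU).
  + apply: contraR dXU => heX.
    rewrite disjoint_sym disjoints_subset subUset sub1set inE heX.
    by rewrite -disjoints_subset disjoint_sym.
Qed.

(** Case of [packing2] whose second root set is all of [V]: every condition on the second part is
    vacuous. *)
Lemma covers_prune S R : covers S R ->
  exists F, [/\ F \subset S, {in F &, injective head},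
    forall e, e \in F -> head e \notin R & covers F R].
Proof.
have noT (X : {set V}) : X != set0 -> [disjoint X & setT] -> False.
  by move=> X0; rewrite disjoints_subset setCT subset0 (negPf X0).
move=> covS; have [|||F [FS injF headF covF _]] := @packing2 S R setT.
- exact: covS.
- by move=> X X0 /noT; case.
- by move=> X X0 _ /noT; case.
- by exists F; split.
Qed.
End Cuts.

(** * Cardinalities of finite sets *)

Lemma subset_interpolate (T : finType) (P Q : {set T}) (n : nat) :
  P \subset Q -> (#|P| <= n <= #|Q|)%N ->
  exists D : {set T}, [/\ P \subset D, D \subset Q & #|D| = n].
Proof.
move=> PQ; elim: n => [|n IHn] /andP [lePn lenQ].
  by exists P; split=> //; apply/eqP; rewrite -leqn0.
move: lePn; rewrite leq_eqVlt => /orP [/eqP cardP | ltPn].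
  by exists P; split.
have [|D [PD DQ cardD]] := IHn; first by rewrite -ltnS ltPn ltnW.
have /properP [_ [x xQ xD]] : D \proper Q by rewrite properEcard DQ cardD.
exists (x |: D); split; last by rewrite cardsU1 xD cardD.
- by apply: subset_trans PD _; apply: subsetUr.
- by rewrite subUset sub1set xQ.
Qed.

Lemma cardsU_disjoint (T : finType) (X Y : {set T}) :
  X :&: Y = set0 -> (#|X| + #|Y| = #|X :|: Y|)%N.
Proof. by rewrite -cardsUI => ->; rewrite cards0 addn0. Qed.

(** * Cut description of [b]-branchings and redistribution of their arcs *)

Section Branchings.
Variables (V A : finType) (tail head : A -> V) (b : V -> int).
Implicit Types (B : {set A}) (R X Y : {set V}).

Definition arcs_at B v := [set a in B | head a == v].

Definition roots B := [set v | indeg head B v < b v].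

Lemma sum_indeg B X :
  \sum_(v in X) indeg head B v
    = #|induced tail head B X|%:Z + #|entering tail head B X|%:Z.
Proof.
rewrite /indeg -(big_morph Posz PoszD (erefl _)) -PoszD; congr Posz.
rewrite cardsU_disjoint; last first.
  by apply/setP => a; rewrite !inE; case: (tail a \in X); rewrite ?andbF.
rewrite (_ : _ :|: _ = [set a in B | head a \in X]); last first.
  by apply/setP => a; rewrite !inE; case: (tail a \in X); rewrite ?andbF ?orbF.
rewrite -sum1dep_card (partition_big head (mem X)) => [|a /andP []//].
apply: eq_bigr => v vX; rewrite -sum1dep_card; apply: eq_bigl => a.
by case: eqP => [->|]; rewrite ?vX ?andbT ?andbF.
Qed.

(** By [sum_indeg], the arcs induced on [X] number the indegree sum minus the entering arcs. If [X]
    avoids the roots this sum is [bsum b X], so the bound asks for one entering arc; if [X] contains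
    a root the sum is already smaller. *)
Lemma is_b_branchingP B :
  is_b_branching tail head b B
    <-> (forall v, indeg head B v <= b v) /\ covers tail head B (roots B).
Proof.
rewrite /is_b_branching; split.
  case/andP => /forallP degB /forallP indB; split=> // X X0 dX.
  have := indB X; rewrite X0 /= => indX.
  have eqX : \sum_(v in X) indeg head B v = bsum b X.
    apply: eq_bigr => v vX; apply/eqP; rewrite eq_le degB /= leNgt.
    by have := disjointFr dX vX; rewrite inE => ->.
  have := sum_indeg B X; rewrite eqX -card_gt0 => eqb.
  rewrite eqb in indX; clear - indX; lia.
case=> degB covB; apply/andP; split; first exact/forallP.
apply/forallP => X; apply/implyP => X0.
have := sum_indeg B X => eqS.
case: (boolP [disjoint X & roots B]) => [/(covB X X0)|].
  rewrite -card_gt0 => gt0.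
  have : \sum_(v in X) indeg head B v <= bsum b X by apply: ler_sum.
  rewrite eqS; clear - gt0; lia.
case/pred0Pn => v /andP [/= vX]; rewrite inE => ltv.
have : \sum_(v in X) indeg head B v < bsum b X.
  rewrite /bsum (bigD1 v) //= [X in _ < X](bigD1 v) //=.
  by apply: ltr_leD => //; apply: ler_sum.
rewrite eqS; clear; lia.
Qed.

Lemma card_arcs_at_UI B1 B2 v :
  (#|arcs_at (B1 :|: B2) v| + #|arcs_at (B1 :&: B2) v|
    = #|arcs_at B1 v| + #|arcs_at B2 v|)%N.
Proof.
by rewrite -[RHS]cardsUI; congr (_ + _)%N; apply: eq_card => a;
  rewrite !inE; case: (head a == v); rewrite ?andbF ?andbT.
Qed.

(* Arcs of [B1 :&: B2] stay in both parts; they are counted twice when the two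
   disjoint branchings are packed, hence the second copy of the arc set. *)
Theorem redistribute B1 B2 (n1 n2 : V -> nat)
    (R1 := [set v | (n1 v)%:Z < b v]) (R2 := [set v | (n2 v)%:Z < b v]) :
    (forall v, n1 v + n2 v = #|arcs_at B1 v| + #|arcs_at B2 v|)%N ->
    (forall v, #|arcs_at (B1 :&: B2) v| <= n1 v)%N ->
    (forall v, #|arcs_at (B1 :&: B2) v| <= n2 v)%N ->
    (forall v, (n1 v)%:Z <= b v) -> (forall v, (n2 v)%:Z <= b v) ->
    covers tail head (B1 :|: B2) R1 -> covers tail head (B1 :|: B2) R2 ->
    (forall X, X != set0 -> [disjoint X & R1] -> [disjoint X & R2] ->
       1 < #|entering tail head B1 X| + #|entering tail head B2 X|)%N ->
  exists D1 D2, [/\ is_b_branching tail head b D1, is_b_branching tail head b D2,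
    (D1 :|: D2 = B1 :|: B2) /\ (D1 :&: D2 = B1 :&: B2),
    forall v, indeg head D1 v = n1 v & forall v, indeg head D2 v = n2 v].
Proof.
move=> n12 n1C n2C n1b n2b cov1 cov2 cov12.
pose hd (e : A * bool) := head e.1; pose tl (e : A * bool) := tail e.1.
pose S := [set e : A * bool | if e.2 then e.1 \in B2 else e.1 \in B1].
have covS R : covers tail head (B1 :|: B2) R -> covers tl hd S R.
  move=> covU X X0 dX; have /set0Pn [a /enteringP [aU ta ha]] := covU X X0 dX.
  apply/set0Pn; case/setUP: aU => aB; [exists (a, false) | exists (a, true)];
    by apply/enteringP; split; rewrite ?inE.
have cardS X : (#|entering tail head B1 X| + #|entering tail head B2 X|
                  <= #|entering tl hd S X|)%N.
  have inj (c : bool) : injective (fun a : A => (a, c)) by move=> ? ? [].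
  rewrite -(card_imset (entering tail head B1 X) (inj false)).
  rewrite -(card_imset (entering tail head B2 X) (inj true)).
  rewrite cardsU_disjoint; last first.
    by apply/setP => e; rewrite !inE; apply/negP => /andP [/imsetP [? _ ->] /imsetP [? _]].
  apply: subset_leq_card; apply/subsetP => e /setUP [] /imsetP [a /enteringP [aB ta ha] ->];
    by apply/enteringP; split; rewrite ?inE.
have [F1 [F1S inj1 head1 covF1 covS1]] :
    exists F : {set A * bool}, [/\ F \subset S, {in F &, injective hd},
      forall e, e \in F -> hd e \notin R1, covers tl hd F R1 & covers tl hd (S :\: F) R2].
  apply: packing2; [exact: covS | exact: covS |] => X X0 dX1 dX2.
  exact: leq_trans (cov12 X X0 dX1 dX2) (cardS X).
have [F2 [F2S inj2 head2 covF2]] := covers_prune covS1.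
(* Only [D] has to be divided, since [C] goes to both parts; [Q F v] collects the arcs of [D] at [v]
   that [F] claims. *)
pose C := B1 :&: B2; pose D := (B1 :|: B2) :\: C.
pose Q (F : {set A * bool}) v := arcs_at D v :&: fst @: F.
have cardD v : (n1 v + n2 v = #|arcs_at D v| + #|arcs_at C v| + #|arcs_at C v|)%N.
  rewrite n12 -card_arcs_at_UI; congr (_ + _)%N.
  rewrite cardsU_disjoint.
    apply: eq_card => a; rewrite !inE.
    by case: (a \in B1); case: (a \in B2); case: (head a == v).
  apply/setP => a; rewrite !inE.
  by case: (a \in B1); case: (a \in B2); case: (head a == v).
(* A claim at [v] is a single arc, and it forces [n' v <= b v <= n v]. As [n v + n' v] exceeds twice
   the number of common arcs at [v], there is room for it in [n v]. *)
have cardQ (F : {set A * bool}) (n n' : V -> nat) v : {in F &, injective hd} ->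
    (forall e, e \in F -> hd e \notin [set v | (n v)%:Z < b v]) ->
    (n v + n' v = #|arcs_at D v| + #|arcs_at C v| + #|arcs_at C v|)%N ->
    (n' v)%:Z <= b v -> (#|arcs_at C v| <= n v)%N -> (#|Q F v| + #|arcs_at C v| <= n v)%N.
  move=> injF headF cD n'b leC.
  have [->|/set0Pn [a]] := eqVneq (Q F v) set0; first by rewrite cards0.
  case/setIP => aD /imsetP [e eF ae].
  have hav : head a = v by move: aD; rewrite inE => /andP [_ /eqP].
  have nb : b v <= (n v)%:Z.
    by move: (headF e eF); rewrite inE /hd -ae hav -leNgt.
  have D0 : (0 < #|arcs_at D v|)%N by rewrite card_gt0; apply/set0Pn; exists a.
  have Q1 : (#|Q F v| <= 1)%N.
    rewrite -(cards1 a); apply: subset_leq_card; apply/subsetP => a'.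
    case/setIP => aD' /imsetP [e' eF' ae']; rewrite inE ae ae'.
    have hav' : head a' = v by move: aD'; rewrite inE => /andP [_ /eqP].
    by apply/eqP; congr fst; apply: injF => //; rewrite /hd -ae -ae' hav hav'.
  clear - cD n'b leC nb D0 Q1; lia.
(* An arc of [D] has only one copy in [S], so the disjoint [F1] and [F2] cannot both claim it. *)
have Q12 v : Q F1 v \subset arcs_at D v :\: Q F2 v.
  apply/subsetP => a /setIP [aD /imsetP [e eF ae]]; apply/setDP; split=> //.
  apply/negP => /setIP [_ /imsetP [e' eF' ae']].
  have /setDP [eS' neF'] := subsetP F2S _ eF'.
  have eS := subsetP F1S _ eF.
  move: aD; rewrite !inE negb_and => /andP [/andP [nC _] _].
  suff ee' : e = e' by rewrite -ee' eF in neF'.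
  move: eS eS' nC ae ae'; rewrite !inE; case: e eF => x [] _; case: e' {eF' neF'} => y [] /=;
    by move=> h1 h2 + ax ay; subst x y; rewrite ?h1 ?h2.
(* At each head, the first part takes all claims of [F1], none of [F2], and enough arcs to reach
   [n1 v] together with [C]. The bounds of [cardQ] for [F1] and [F2] make this size attainable. *)
have /fin_all_exists [f fP] v : exists Dv : {set A},
    [/\ Q F1 v \subset Dv, Dv \subset arcs_at D v :\: Q F2 v
      & #|Dv| = (n1 v - #|arcs_at C v|)%N].
  apply: subset_interpolate => //.
  have le1 := cardQ F1 n1 n2 v inj1 head1 (cardD v) (n2b v) (n1C v).
  have le2 : (#|Q F2 v| + #|arcs_at C v| <= n2 v)%N.
    by apply: (cardQ F2 n2 n1) => //; rewrite addnC.
  have := cardD v; have := cardsID (Q F2 v) (arcs_at D v).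
  rewrite (_ : arcs_at D v :&: Q F2 v = Q F2 v); last by rewrite setIA setIid.
  move: #|_ :\: _| le1 le2; clear; lia.
pose D1 := C :|: [set a in D | a \in f (head a)].
pose D2 := C :|: [set a in D | a \notin f (head a)].
have UE : D1 :|: D2 = B1 :|: B2.
  apply/setP => a; rewrite !inE.
  by case: (a \in B1); case: (a \in B2); case: (a \in f _).
have IE : D1 :&: D2 = B1 :&: B2.
  apply/setP => a; rewrite !inE.
  by case: (a \in B1); case: (a \in B2); case: (a \in f _).
have deg1 v : #|arcs_at D1 v| = n1 v.
  have [_ fD cf] := fP v.
  have fDv a : a \in f v -> (a \in D) /\ head a = v.
    by move/(subsetP fD); rewrite inE => /andP [_]; rewrite inE => /andP [-> /eqP].
  rewrite -(subnKC (n1C v)) -cf cardsU_disjoint.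
    apply: eq_card => a; rewrite /D1 /arcs_at !(in_setU, in_set).
    case: eqP => [hv|ne]; rewrite ?andbT ?andbF /=; last first.
      by apply/esym/negP => /fDv [_ /ne].
    subst v; case: (boolP (a \in f _)) => [/fDv [aD _]|_]; last by rewrite andbF.
    by move: aD; rewrite !inE; case: (a \in B1); case: (a \in B2).
  apply/setP => a; rewrite in_setI in_set0; apply/negP => /andP [+ /fDv [aD _]].
  rewrite in_set => /andP [aC _].
  by move: aD; rewrite in_setD aC.
(* The second indegree is the complement of the first in the total, which union and intersection
   determine. *)
have deg2 v : #|arcs_at D2 v| = n2 v.
  by apply/eqP; rewrite -(eqn_add2l (n1 v)) n12 -card_arcs_at_UI -UE -IE card_arcs_at_UI deg1.
have SU e : e \in S -> e.1 \in B1 :|: B2.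
  by rewrite !inE; case: e.2 => ->; rewrite ?orbT.
exists D1, D2; split=> //; try by move=> v; rewrite /indeg -/(arcs_at _ v) ?deg1 ?deg2.
- apply/is_b_branchingP; split=> [v|]; first by rewrite /indeg -/(arcs_at _ v) deg1.
  have -> : roots D1 = R1 by apply/setP => v; rewrite !inE /indeg -/(arcs_at _ v) deg1.
  move=> X X0 dX; have /set0Pn [e /enteringP [eF te he]] := covF1 X X0 dX.
  apply/set0Pn; exists e.1; apply/enteringP; split=> //.
  have eU := SU e (subsetP F1S _ eF).
  rewrite in_setU; case: (boolP (e.1 \in C)) => //= eC.
  have eD : e.1 \in D by rewrite in_setD eC.
  rewrite in_set eD; have [sQ _ _] := fP (head e.1).
  by apply: (subsetP sQ); rewrite in_setI in_set eD eqxx imset_f.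
- apply/is_b_branchingP; split=> [v|]; first by rewrite /indeg -/(arcs_at _ v) deg2.
  have -> : roots D2 = R2 by apply/setP => v; rewrite !inE /indeg -/(arcs_at _ v) deg2.
  move=> X X0 dX; have /set0Pn [e /enteringP [eF te he]] := covF2 X X0 dX.
  apply/set0Pn; exists e.1; apply/enteringP; split=> //.
  have /setDP [eS _] := subsetP F2S _ eF; have eU := SU e eS.
  rewrite in_setU; case: (boolP (e.1 \in C)) => //= eC.
  have eD : e.1 \in D by rewrite in_setD eC.
  rewrite in_set eD; have [_ sQ _] := fP (head e.1).
  apply/negP => /(subsetP sQ) /setDP [_ /negP]; apply.
  by rewrite in_setI in_set eD eqxx imset_f.
Qed.

(** * Exchange of one unit of indegree between two [b]-branchings *)

Theorem b_branching_exchange B1 B2 u :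
    is_b_branching tail head b B1 -> is_b_branching tail head b B2 ->
    indeg head B1 u < indeg head B2 u ->
  exists D1 D2, [/\ is_b_branching tail head b D1, is_b_branching tail head b D2,
    (D1 :|: D2 = B1 :|: B2) /\ (D1 :&: D2 = B1 :&: B2)
    & (forall t, indeg head D1 t = indeg head B1 t + unitv u t
         /\ indeg head D2 t = indeg head B2 t - unitv u t)
      \/ exists v, [/\ v != u, indeg head B2 v < indeg head B1 v
        & forall t, indeg head D1 t = indeg head B1 t + unitv u t - unitv v t
            /\ indeg head D2 t = indeg head B2 t - unitv u t + unitv v t]].
Proof.
move=> /is_b_branchingP [deg1 cov1] /is_b_branchingP [deg2 cov2] ltu.
pose d1 v := #|arcs_at B1 v|; pose d2 v := #|arcs_at B2 v|.
have C1 v : (#|arcs_at (B1 :&: B2) v| <= d1 v)%N.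
  apply: subset_leq_card; apply/subsetP => a; rewrite !inE.
  by case/andP => /andP [-> _].
have C2 v : (#|arcs_at (B1 :&: B2) v| <= d2 v)%N.
  apply: subset_leq_card; apply/subsetP => a; rewrite !inE.
  by case/andP => /andP [_ ->].
have le1 v : (d1 v)%:Z <= b v := deg1 v.
have le2 v : (d2 v)%:Z <= b v := deg2 v.
have {}ltu : (d1 u < d2 u)%N by [].
have inR2 v : (v \in roots B2) = ((d2 v)%:Z < b v) by rewrite inE.
pose in0 X := (entering tail head B1 X == set0) && (entering tail head B2 X == set0).
have coverU R : (forall X, X != set0 -> [disjoint X & R] -> ~~ in0 X) ->
    covers tail head (B1 :|: B2) R.
  move=> H X X0 dX; have := H X X0 dX; rewrite negb_and => /orP [] /set0Pn [a];
    by case/enteringP => aB ta ha; apply/set0Pn; exists a; apply/enteringP;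
       rewrite inE aB ?orbT.
have not0 X : X != set0 -> [disjoint X & roots B1] || [disjoint X & roots B2] -> ~~ in0 X.
  by move=> X0 /orP [/cov1|/cov2] H; rewrite negb_and H ?orbT.
have two X : X != set0 -> [disjoint X & roots B1] -> [disjoint X & roots B2] ->
    (1 < #|entering tail head B1 X| + #|entering tail head B2 X|)%N.
  move=> X0 /(cov1 X X0) H1 /(cov2 X X0) H2.
  by move: H1 H2; rewrite -!card_gt0; apply: leq_add.
pose n1 t := (d1 t + (t == u))%N; pose n2 t := (d2 t - (t == u))%N.
have E2 t : (n2 t)%:Z = (d2 t)%:Z - unitv u t.
  rewrite /n2 /unitv; case: eqP => [->|_] /=; last by rewrite subn0 subr0.
  by rewrite subzn //; apply: leq_ltn_trans ltu.
pose R1 := [set v | (n1 v)%:Z < b v].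
have nR1 v : v \notin R1 -> v != u -> v \notin roots B1.
  by move=> + vu; rewrite !inE /n1 (negPf vu) addn0.
have nR2 v (R2 := [set v | (n2 v)%:Z < b v]) : v \notin R2 -> v \notin roots B2.
  rewrite !inE /n2; apply: contra; apply: le_lt_trans; rewrite lez_nat; exact: leq_subr.
pose bad X := [&& u \in X, in0 X & [disjoint X & R1]].
have [/existsP exbad | /existsPn nobad] := boolP [exists X, bad X]; last first.
  (* Lowering [d2 u] makes [u] a root of the second part, so sets avoiding [R2] miss [u]. The cut
     condition could then fail only on sets containing [u] and avoiding [R1], and none of these is
     bad. *)
  pose R2 := [set v | (n2 v)%:Z < b v].
  have uR2 : u \in R2.
    rewrite inE /n2 eqxx; move: ltu (le2 u); case: (d2 u) => // m _.
    by rewrite subn1 /=; apply: lt_le_trans; rewrite ltz_nat.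
  have sub1 X : u \notin X -> [disjoint X & R1] -> [disjoint X & roots B1].
    move=> uX /disjointFr dX; apply/pred0P => v /=; apply/negP => /andP [vX].
    apply/negP; apply: nR1; first by rewrite dX.
    by apply: contraNneq uX => <-.
  have sub2 X : [disjoint X & R2] -> u \notin X /\ [disjoint X & roots B2].
    move=> dX; split; first by rewrite (disjointFl dX uR2).
    apply/pred0P => v /=; apply/negP => /andP [vX].
    by apply/negP; apply: nR2; rewrite (disjointFr dX vX).
  have [|||||||X X0 dX1 dX2|D1 [D2 [br1 br2 UI e1 e2]]] :=
    @redistribute B1 B2 n1 n2.
  - move=> v; rewrite /n1 /n2 -/(d1 v) -/(d2 v).
    by case: eqP => [->|_] /=; move: ltu; clear; lia.
  - by move=> v; rewrite /n1 (leq_trans (C1 v)) ?leq_addr.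
  - move=> v; rewrite /n2; case: eqP => [->|_]; last by rewrite subn0.
    by move: (C1 u) ltu; clear; lia.
  - move=> v; rewrite /n1; case: eqP => [->|_]; last by rewrite addn0.
    by move: (le2 u) ltu; clear; lia.
  - by move=> v; move: (le2 v); rewrite /n2; clear; lia.
  - apply: coverU => X X0 dX.
    case: (boolP (u \in X)) => uX; last by rewrite not0 // sub1.
    by have := nobad X; rewrite /bad uX dX andbT.
  - by apply: coverU => X X0 /sub2 [_ dX]; rewrite not0 // dX orbT.
  - by have [uX dX] := sub2 X dX2; apply: two => //; apply: sub1.
  - exists D1, D2; split=> //; left=> t; rewrite e1 e2 E2; split=> //.
have [X /minsetP [/and3P [uX X0 dXR1] minX]] := ex_minset exbad.
have Xn0 : X != set0 by apply/set0Pn; exists u.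
have : ~~ [disjoint X & roots B2].
  by apply: contraL X0 => dX; rewrite not0 // dX orbT.
case/pred0Pn => v /andP [/= vX]; rewrite inR2 => vR2.
(* Since [u] is not in [R1], [b u <= d1 u + 1 <= d2 u], so [u] is not a root of [B2]. *)
have vu : v != u.
  apply: contraTneq vR2 => ->; have := disjointFr dXR1 uX; rewrite inE /n1 eqxx.
  by move: ltu; clear; lia.
have d1v : b v <= (d1 v)%:Z.
  by have := disjointFr dXR1 vX; rewrite inE /n1 (negPf vu) addn0; clear; lia.
have ltv : (d2 v < d1 v)%N by move: d1v vR2; clear; lia.
pose m1 t := (n1 t - (t == v))%N; pose m2 t := (n2 t + (t == v))%N.
have m1v t : t != v -> m1 t = n1 t by rewrite /m1 => /negPf ->; rewrite subn0.
have m2v t : t != v -> m2 t = n2 t by rewrite /m2 => /negPf ->; rewrite addn0.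
have m1E : m1 v = (d1 v).-1 by rewrite /m1 /n1 (negPf vu) eqxx addn0 subn1.
have m2E : m2 v = (d2 v).+1 by rewrite /m2 /n2 (negPf vu) eqxx subn0 addn1.
pose R2 := [set t | (m2 t)%:Z < b t]; pose S1 := [set t | (m1 t)%:Z < b t].
have uR2 : u \in R2.
  rewrite inE m2v 1?eq_sym // /n2 eqxx.
  by move: ltu (le2 u); clear; lia.
have vS1 : v \in S1.
  by rewrite inE m1E; move: ltv (le1 v); clear; lia.
have sS1 Y : [disjoint Y & S1] -> v \notin Y /\ [disjoint Y & R1].
  move=> dY; split; first by rewrite (disjointFl dY vS1).
  rewrite disjoint_sym; apply: disjointWl; last by rewrite disjoint_sym; exact: dY.
  apply/subsetP => t; rewrite !inE /m1; apply: le_lt_trans.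
  by rewrite lez_nat leq_subr.
have sub1 Y : u \notin Y -> [disjoint Y & R1] -> [disjoint Y & roots B1].
  move=> uY /disjointFr dY; apply/pred0P => t /=; apply/negP => /andP [tY].
  apply/negP; apply: nR1; first by rewrite dY.
  by apply: contraNneq uY => <-.
have sub2 Y : v \notin Y -> [disjoint Y & R2] -> [disjoint Y & roots B2].
  move=> vY dY; apply/pred0P => t /=; apply/negP => /andP [tY].
  apply/negP; apply: nR2; have := disjointFr dY tY; rewrite !inE m2v => [->//|].
  by apply: contraNneq vY => <-.
(* By submodularity, sets without entering arcs are closed under intersection. *)
have in0I Y : in0 Y -> in0 (X :&: Y).
  move=> Y0; move: X0 Y0; rewrite /in0 -!cards_eq0 => /andP [/eqP x1 /eqP x2] /andP [/eqP y1 /eqP y2].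
  have := entering_submod tail head B1 X Y; rewrite x1 y1.
  have := entering_submod tail head B2 X Y; rewrite x2 y2.
  by rewrite !leqn0 !addn_eq0 => /andP [-> _] /andP [-> _].
have [|||||||Y Y0 dY1 dY2|D1 [D2 [br1 br2 UI e1 e2]]] :=
  @redistribute B1 B2 m1 m2.
- move=> t; rewrite -/(d1 t) -/(d2 t).
  have [->|tv] := eqVneq t v; first by rewrite m1E m2E; move: ltv; clear; lia.
  rewrite m1v // m2v // /n1 /n2.
  by case: eqP => [->|_] /=; move: ltu; clear; lia.
- move=> t; have [->|tv] := eqVneq t v.
    by rewrite m1E; move: ltv (C2 v); clear; lia.
  by rewrite m1v // /n1 (leq_trans (C1 t)) ?leq_addr.
- move=> t; rewrite /m2 /n2; apply: leq_trans (leq_addr _ _).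
  case: eqP => [->|_]; last by rewrite subn0.
  by move: (C1 u) ltu; clear; lia.
- move=> t; rewrite /m1 /n1; case: eqP => [->|_]; last first.
    by rewrite addn0; move: (le1 t); clear; lia.
  by move: (le2 u) ltu; clear; lia.
- move=> t; have [->|tv] := eqVneq t v; first by rewrite m2E; move: vR2; clear; lia.
  by rewrite m2v //; move: (le2 t); rewrite /n2; clear; lia.
(* A violating [Y] contains [u] and misses [v], so [X :&: Y] would be a bad set strictly inside the
   minimal [X]. *)
- apply: coverU => Y Y0 /sS1 [vY dY].
  case: (boolP (u \in Y)) => uY; last by rewrite not0 // sub1.
  apply/negP => /in0I XY0.
  have XYX : X :&: Y = X.
    apply: minX; last exact: subsetIl.
    by rewrite /bad inE uX uY XY0 /=; apply: disjointWl dY; apply: subsetIr.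
  by move: vX; rewrite -XYX inE (negPf vY) andbF.
(* If [Y] contains [v], then [X :&: Y] is nonempty, misses [u] and avoids the roots of [B1]. An arc
   of [B1] therefore enters it, which [in0I] forbids when [Y] is not entered. *)
- apply: coverU => Y Y0 dY.
  case: (boolP (v \in Y)) => vY; last by rewrite not0 // sub2 ?orbT.
  have uY : u \notin Y by rewrite (disjointFl dY uR2).
  apply/negP => /in0I; apply/negP; apply: not0.
    by apply/set0Pn; exists v; rewrite inE vX.
  rewrite sub1 //; first by rewrite inE (negPf uY) andbF.
  by apply: disjointWl dXR1; apply: subsetIl.
- have [vY dY] := sS1 Y dY1.
  have uY : u \notin Y by rewrite (disjointFl dY2 uR2).
  by apply: two => //; [apply: sub1 | apply: sub2].
- exists D1, D2; split=> //; right; exists v; split=> // t.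
  rewrite e1 e2; have [->|tv] := eqVneq t v.
    rewrite m1E m2E /indeg -/(arcs_at B1 v) -/(arcs_at B2 v) -/(d1 v) -/(d2 v).
    by rewrite /unitv (negPf vu) eqxx; move: ltv; clear; lia.
  by rewrite m1v // m2v // E2 /n1 [unitv v t]/unitv (negPf tv) subr0 addr0 PoszD.
Qed.
End Branchings.

(** * Weights and the minimum defining [gfun] *)

Section Weights.
Variables (V A : finType) (tail head : A -> V) (b : V -> int).
Variables (R : realFieldType) (w : A -> R).
Implicit Types (B : {set A}) (x y : V -> int).

Lemma wsum_UI B1 B2 :
  wsum w (B1 :|: B2) + wsum w (B1 :&: B2) = wsum w B1 + wsum w B2.
Proof.
rewrite /wsum !(big_mkcond (fun a => a \in _)) /= -!big_split /=.
apply: eq_bigr => a _; rewrite !inE.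
by case: (a \in B1); case: (a \in B2); rewrite ?addr0 ?add0r.
Qed.

Lemma bigemin_witness (P : pred {set A}) m :
  \big[@emin R/None]_(B : {set A} | P B) Some (wsum w B) = Some m ->
  exists2 B, P B & wsum w B = m.
Proof.
elim: (index_enum _) m => [|B s IH] m; rewrite ?big_nil ?big_cons //.
case: ifP => [PB|_ /IH //]; case: (\big[_/_]_(_ <- s | _) _) IH => [q|] IH [<-]; last by exists B.
by case: (leP (wsum w B) q) => _; [exists B | apply: IH].
Qed.

Lemma bigemin_le (P : pred {set A}) B : P B ->
  ege (Some (wsum w B)) (\big[@emin R/None]_(B : {set A} | P B) Some (wsum w B)).
Proof.
move=> PB; have := mem_index_enum B.
elim: (index_enum _) => // B' s IH; rewrite inE big_cons => /predU1P [<-|/IH {}IH].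
  by rewrite PB; case: (\big[_/_]_(_ <- s | _) _) => [q|] /=; rewrite ?ge_min lexx.
case: (P B') => //; move: IH; case: (\big[_/_]_(_ <- s | _) _) => [q|] //= le.
by rewrite ge_min le orbT.
Qed.

Lemma gfun_witness x m : gfun tail head b w x = Some m ->
  [forall v, 0 <= x v] /\ exists2 B, feasible tail head b x B & wsum w B = m.
Proof. by rewrite /gfun; case: ifP => // x0 /bigemin_witness. Qed.

Lemma gfun_le x B : (forall v, 0 <= x v) -> feasible tail head b x B ->
  ege (Some (wsum w B)) (gfun tail head b w x).
Proof. by move=> /forallP x0; rewrite /gfun x0 => /bigemin_le. Qed.

(** Equal union and intersection give equal total weight, so [D1] and [D2] witness the bound however
    the arcs were divided. *)
Lemma gfun_add_le x y B1 B2 D1 D2 :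
    (forall v, 0 <= x v) -> (forall v, 0 <= y v) ->
    feasible tail head b x D1 -> feasible tail head b y D2 ->
    D1 :|: D2 = B1 :|: B2 /\ D1 :&: D2 = B1 :&: B2 ->
  ege (Some (wsum w B1 + wsum w B2))
      (eadd (gfun tail head b w x) (gfun tail head b w y)).
Proof.
move=> x0 y0 /(gfun_le x0) + /(gfun_le y0) + [UE IE].
rewrite -wsum_UI -UE -IE wsum_UI.
by case: (gfun _ _ _ _ x) => //= p; case: (gfun _ _ _ _ y) => //= q; apply: lerD.
Qed.
End Weights.

(** * The exchange inequality for [gfun] *)

Theorem mainTheorem7 (R : realFieldType) (V A : finType) (tail head : A -> V)
  (loopless : forall a : A, tail a != head a)
  (w : A -> R) (w_nonneg : forall a, 0 <= w a)
  (b : V -> int) (b_pos : forall v, 0 < b v) :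
  Mnat_convex (gfun tail head b w).
Proof.
move=> x y u lt_yx.
case gx: (gfun tail head b w x) => [m1|]; last by left.
case gy: (gfun tail head b w y) => [m2|]; last by left.
have [/forallP x0 [B1 /andP [br1 /forallP cov1] <-]] := gfun_witness gx.
have [/forallP y0 [B2 /andP [br2 /forallP cov2] <-]] := gfun_witness gy.
rewrite [eadd (Some _) _]/=.
have unitE s t : unitv s t = if t == s then 1 else 0 :> int.
  by rewrite /unitv; case: eqP.
have xu0 t : 0 <= x t - unitv u t.
  rewrite unitE; case: eqP => [->|_]; last by rewrite subr0.
  by move: (y0 u) lt_yx; clear; lia.
have yu0 t : 0 <= y t + unitv u t.
  by rewrite unitE; move: (y0 t); case: eqP => _; clear; lia.
(* With slack at [u], the same two branchings remain feasible after [x u] drops by one. Otherwise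
   [indeg B1 u <= b u - x u < b u - y u <= indeg B2 u], and the exchange applies at [u]. *)
case: (ltP (b u) (indeg head B1 u + x u)) => [slack|tight].
  left; apply: (@gfun_add_le _ _ _ _ _ _ _ _ _ B1 B2 B1 B2) => //.
  - rewrite /feasible br1; apply/forallP => t; rewrite unitE.
    case: eqP => [->|_]; last by rewrite subr0.
    by move: slack; clear; lia.
  - rewrite /feasible br2; apply/forallP => t; rewrite unitE.
    by move: (cov2 t); case: eqP => _; clear; lia.
have ltu : indeg head B1 u < indeg head B2 u.
  by move: (cov2 u) lt_yx tight; clear; lia.
have [D1 [D2 [br1' br2' UI [degD|[v [vu ltv degD]]]]]] :=
  b_branching_exchange br1 br2 ltu.
  left; apply: (@gfun_add_le _ _ _ _ _ _ _ _ _ B1 B2 D1 D2) => //.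
  - rewrite /feasible br1'; apply/forallP => t; rewrite (degD t).1.
    by move: (cov1 t); clear; lia.
  - rewrite /feasible br2'; apply/forallP => t; rewrite (degD t).2.
    by move: (cov2 t); clear; lia.
(* The vertex [v] compares indegrees, not [x] and [y], so it need not lie in the negative support of
   [x - y]. When it does, [y v > x v >= 0] keeps [y v - 1] nonnegative. *)
have [lt_xy|le_yx] := ltP (x v) (y v).
  right; exists v; split=> //.
  apply: (@gfun_add_le _ _ _ _ _ _ _ _ _ B1 B2 D1 D2) => //.
  - move=> t; move: (xu0 t); rewrite [unitv v t]unitE.
    by case: (t == v); clear; lia.
  - move=> t; rewrite [unitv v t]unitE; case: eqP => [->|_]; last by rewrite subr0.
    by rewrite unitE (negPf vu); move: (x0 v) lt_xy; clear; lia.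
  - rewrite /feasible br1'; apply/forallP => t; rewrite (degD t).1.
    by move: (cov1 t); clear; lia.
  - rewrite /feasible br2'; apply/forallP => t; rewrite (degD t).2.
    by move: (cov2 t); clear; lia.
(* Since [x v >= y v], the demand at [v] is still met by [D1] without raising
   [x v]: [indeg B1 v - 1 + x v >= indeg B2 v + y v >= b v]. *)
left; apply: (@gfun_add_le _ _ _ _ _ _ _ _ _ B1 B2 D1 D2) => //.
- rewrite /feasible br1'; apply/forallP => t; rewrite (degD t).1 [unitv v t]unitE.
  case: eqP => [->|_]; last by move: (cov1 t); clear; lia.
  by move: (cov2 v) ltv le_yx; clear; lia.
- rewrite /feasible br2'; apply/forallP => t; rewrite (degD t).2 [unitv v t]unitE.
  by move: (cov2 t); case: eqP => _; clear; lia.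
Qed.
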